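(* Let $N\ge2$ and let $\mathcal{U}_{\mathcal{F}}(sl(N))$ be the algebra $\mathcal{U}(sl(N))[[\xi]]$ (over $\mathbb{C}[[\xi]]$) with coproduct $\Delta_{\mathcal{F}}(a)=\mathcal{F}\Delta(a)\mathcal{F}^{-1}$, where $$\mathcal{F}=\exp(H_{1N}\otimes\sigma)\prod_{j=2}^{N-1}\exp\left(2\xi E_{1j}\otimes E_{jN}e^{-2\sigma}\right),\qquad \sigma=\tfrac12\ln(1+2\xi E_{1N}),\quad H_{1N}=E_{11}-E_{NN}.$$ Then the anti-linear map $\theta$ given by $$\theta(E_{ij})=-E_{ij}\ \ (i,j<N\ \text{or}\ i=j=N),\qquad \theta(E_{kN})=E_{kN},\quad \theta(E_{Nk})=E_{Nk}\ \ (k<N)$$ defines an anti-automorphism of the Lie algebra $sl(N)$, and its extension to an anti-linear algebra anti-homomorphism is a real form of $\mathcal{U}_{\mathcal{F}}(sl(N))$, i.e. $\theta$ is an anti-homomorphism of algebras and a homomorphism of coalgebras: $(\theta\otimes\theta)\circ\Delta_{\mathcal{F}}=\Delta_{\mathcal{F}}\circ\theta$.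
   Context: $E_{ij}$ are the matrix units of $gl(N)$ over $\mathbb{C}$; the formulas for $\theta$ are on the basis of $gl(N)$ and are restricted to $sl(N)$. $\Delta$ is the standard cocommutative coproduct, $\Delta(Y)=Y\otimes1+1\otimes Y$ for $Y\in sl(N)$. $\xi$ is a formal parameter treated as real, i.e. $\theta(\xi)=\xi$ and $\theta$ acts on complex scalars by complex conjugation; tensor products are $\xi$-adically completed. An anti-automorphism of a Lie algebra satisfies $\theta([a,b])=[\theta(b),\theta(a)]$. *)

(* Defs.v *)
From HB Require Import structures.
From mathcomp Require Import all_boot all_order all_algebra.
From mathcomp Require Import boolp reals.
From mathcomp Require Import complex.

Set Implicit Arguments.
Unset Strict Implicit.
Unset Printing Implicit Defensive.

Import GRing.Theory Num.Theory.

Local Open Scope ring_scope.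

(* [Fps c] is the formal power series sum_n (c n) xi^n, with [xi] central. *)
Record fps (A : Type) := Fps { coef : nat -> A }.

Lemma fpsP (A : Type) (a b : fps A) : coef a =1 coef b -> a = b.
Proof. by case: a b => [a] [b] /= /funext ->. Qed.

HB.instance Definition _ (A : Type) := gen_eqMixin (fps A).
HB.instance Definition _ (A : Type) := gen_choiceMixin (fps A).

Definition fps_map (A B : Type) (f : A -> B) (a : fps A) : fps B :=
  Fps (fun n => f (coef a n)).

Definition fps_const (A : zmodType) (x : A) : fps A :=
  Fps (fun n => if n == 0%N then x else 0).

Definition xi (K : nzRingType) : fps K := Fps (fun n => (n == 1%N)%:R).
Arguments xi {K}.

(* The [xi]-bilinear extension of [op]: the product of [A[[xi]]] when [op] is
   the product of [A], the action of [K[[xi]]] on [V[[xi]]] when [op] is the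
   action of [K] on [V], and a (x) b in (A (x) B)[[xi]], the [xi]-adic completion
   of the tensor product of A[[xi]] and B[[xi]] over K[[xi]], when [op] is
   (x). *)
Definition fps_conv (A B : Type) (V : zmodType) (op : A -> B -> V)
    (a : fps A) (b : fps B) : fps V :=
  Fps (fun n => \sum_(i < n.+1) op (coef a i) (coef b (n - i))).

Section FpsZmod.
Variable A : zmodType.
Implicit Types a b c : fps A.

Let add a b : fps A := Fps (fun n => coef a n + coef b n).
Let opp a : fps A := Fps (fun n => - coef a n).
Let zero : fps A := Fps (fun=> 0).

Fact fps_addA : associative add.
Proof. by move=> a b c; apply: fpsP => n /=; rewrite addrA. Qed.
Fact fps_addC : commutative add.
Proof. by move=> a b; apply: fpsP => n /=; rewrite addrC. Qed.
Fact fps_add0 : left_id zero add.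
Proof. by move=> a; apply: fpsP => n /=; rewrite add0r. Qed.
Fact fps_addN : left_inverse zero opp add.
Proof. by move=> a; apply: fpsP => n /=; rewrite addNr. Qed.

HB.instance Definition _ :=
  GRing.isZmodule.Build (fps A) fps_addA fps_addC fps_add0 fps_addN.

Lemma fps_coefD a b n : coef (a + b) n = coef a n + coef b n. Proof. by []. Qed.
Lemma fps_coefN a n : coef (- a) n = - coef a n. Proof. by []. Qed.

End FpsZmod.

Section Triangle.
Variables (V : zmodType) (F : nat -> nat -> V).

Lemma sum_triangle n :
  \sum_(i < n.+1) \sum_(j < i.+1) F i j =
  \sum_(j < n.+1) \sum_(k < (n - j).+1) F (j + k)%N j.
Proof.
elim: n => [|n IHn]; first by rewrite !big_ord1 /= ?big_ord1.
rewrite big_ord_recr /= IHn [RHS]big_ord_recr /= subnn big_ord1 addn0.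
rewrite [X in _ + X]big_ord_recr /= addrA -big_split /=; congr (_ + _).
apply: eq_bigr => j _; have le_jn : (j <= n)%N by rewrite -ltnS.
by rewrite subSn // [RHS]big_ord_recr /= addnS subnKC.
Qed.

Lemma sum_triangleC n :
  \sum_(i < n.+1) \sum_(j < (n - i).+1) F i j =
  \sum_(j < n.+1) \sum_(i < (n - j).+1) F i j.
Proof.
have widen (G : nat -> V) i : \sum_(j < (n - i).+1) G j =
    \sum_(j < n.+1 | (j < (n - i).+1)%N) G j.
  by apply: big_ord_widen; rewrite ltnS leq_subr.
under eq_bigr => i _ do rewrite (widen (F i)).
under [RHS]eq_bigr => j _ do rewrite (widen (F^~ j)).
rewrite (exchange_big_dep predT) //=; apply: eq_bigr => j _.
apply: eq_bigl => i; rewrite !ltnS.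
have := ltn_ord i; have := ltn_ord j; rewrite !ltnS => le_jn le_in.
by rewrite !leq_subRL // addnC.
Qed.

End Triangle.

Section FpsRing.
Variable A : nzRingType.
Implicit Types a b c : fps A.

Let mul a b : fps A := fps_conv *%R a b.
Let one : fps A := fps_const 1.

Fact fps_mulA : associative mul.
Proof.
move=> a b c; apply: fpsP => n /=.
transitivity (\sum_(j < n.+1) \sum_(k < (n - j).+1)
    coef a j * coef b k * coef c (n - (j + k))).
  apply: eq_bigr => j _; rewrite big_distrr /=; apply: eq_bigr => k _.
  by rewrite mulrA subnDA.
pose F i j := coef a j * coef b (i - j) * coef c (n - i).
transitivity (\sum_(i < n.+1) \sum_(j < i.+1) F i j); last first.
  by apply: eq_bigr => i _; rewrite big_distrl.
rewrite sum_triangle; apply: eq_bigr => j _; apply: eq_bigr => k _.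
by rewrite /F addKn.
Qed.

Fact fps_mul1 : left_id one mul.
Proof.
move=> a; apply: fpsP => n /=; rewrite big_ord_recl /= subn0 mul1r.
by rewrite big1 ?addr0 // => i _; rewrite mul0r.
Qed.

Fact fps_mulr1 : right_id one mul.
Proof.
move=> a; apply: fpsP => n /=; rewrite big_ord_recr /= subnn mulr1.
rewrite big1 ?add0r // => i _.
by rewrite subn_eq0 leqNgt ltn_ord /= mulr0.
Qed.

Fact fps_mulDl : left_distributive mul +%R.
Proof.
move=> a b c; apply: fpsP => n; rewrite fps_coefD /= -big_split /=.
by apply: eq_bigr => i _; rewrite mulrDl.
Qed.

Fact fps_mulDr : right_distributive mul +%R.
Proof.
move=> a b c; apply: fpsP => n; rewrite fps_coefD /= -big_split /=.
by apply: eq_bigr => i _; rewrite mulrDr.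
Qed.

Fact fps_oner_neq0 : one != 0.
Proof.
apply/eqP => /(congr1 (fun a => coef a 0%N)) /= /eqP.
by rewrite oner_eq0.
Qed.

HB.instance Definition _ := GRing.Zmodule_isNzRing.Build (fps A)
  fps_mulA fps_mul1 fps_mulr1 fps_mulDl fps_mulDr fps_oner_neq0.

Lemma fps_mulE a b : a * b = fps_conv *%R a b. Proof. by []. Qed.
Lemma fps_oneE : 1 = fps_const 1 :> fps A. Proof. by []. Qed.

Let invertible a b := b * a = 1 /\ a * b = 1.
Let unit a : bool := `[< exists b, invertible a b >].
Let inv a : fps A :=
  if pselect (exists b, invertible a b) is left ex then projT1 (cid ex) else a.

Fact fps_mulVr : {in unit, left_inverse 1 inv *%R}.
Proof.
move=> a; rewrite unfold_in /unit /inv => /asboolP ex.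
by case: pselect => // ex'; case: (projT2 (cid ex')).
Qed.

Fact fps_divrr : {in unit, right_inverse 1 inv *%R}.
Proof.
move=> a; rewrite unfold_in /unit /inv => /asboolP ex.
by case: pselect => // ex'; case: (projT2 (cid ex')).
Qed.

Fact fps_unitrP a b : b * a = 1 /\ a * b = 1 -> unit a.
Proof. by move=> ab; apply/asboolP; exists b. Qed.

Fact fps_invr_out : {in [predC unit], inv =1 id}.
Proof.
move=> a; rewrite inE /= unfold_in /unit /inv => /asboolPn nex.
by case: pselect.
Qed.

HB.instance Definition _ := GRing.NzRing_hasMulInverse.Build (fps A)
  fps_mulVr fps_divrr fps_unitrP fps_invr_out.

End FpsRing.

Section FpsLmod.
Variables (K : nzRingType) (V : lmodType K).
Implicit Types (k l : fps K) (v w : fps V).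

Let scale k v : fps V := fps_conv *:%R k v.

Fact fps_scaleA k l v : scale k (scale l v) = scale (k * l) v.
Proof.
apply: fpsP => n /=.
transitivity (\sum_(i < n.+1) \sum_(j < (n - i).+1)
    (coef k i * coef l j) *: coef v (n - (i + j))).
  apply: eq_bigr => i _; rewrite scaler_sumr; apply: eq_bigr => j _.
  by rewrite scalerA subnDA.
pose F i j := (coef k j * coef l (i - j)) *: coef v (n - i).
transitivity (\sum_(i < n.+1) \sum_(j < i.+1) F i j); last first.
  by apply: eq_bigr => i _; rewrite -scaler_suml.
rewrite sum_triangle; apply: eq_bigr => i _; apply: eq_bigr => j _.
by rewrite /F addKn.
Qed.

Fact fps_scale1 : left_id 1 scale.
Proof.
move=> v; apply: fpsP => n /=; rewrite big_ord_recl /= subn0 scale1r.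
by rewrite big1 ?addr0 // => i _; rewrite scale0r.
Qed.

Fact fps_scaleDr : right_distributive scale +%R.
Proof.
move=> k v w; apply: fpsP => n; rewrite fps_coefD /= -big_split /=.
by apply: eq_bigr => i _; rewrite scalerDr.
Qed.

Fact fps_scaleDl v : {morph scale^~ v : k l / k + l}.
Proof.
move=> k l; apply: fpsP => n; rewrite fps_coefD /= -big_split /=.
by apply: eq_bigr => i _; rewrite scalerDl.
Qed.

HB.instance Definition _ := GRing.Zmodule_isLmodule.Build (fps K) (fps V)
  fps_scaleA fps_scale1 fps_scaleDr fps_scaleDl.

Lemma fps_scaleE k v : k *: v = fps_conv *:%R k v. Proof. by []. Qed.

End FpsLmod.

Section FpsAlg.
Variables (K : nzRingType) (A : algType K).
Implicit Types (k : fps K) (a b : fps A).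

Fact fps_scaleAl k a b : k *: (a * b) = (k *: a) * b.
Proof.
apply: fpsP => n; rewrite !fps_scaleE !fps_mulE /=.
transitivity (\sum_(i < n.+1) \sum_(j < (n - i).+1)
    (coef k i *: coef a j) * coef b (n - (i + j))).
  apply: eq_bigr => i _; rewrite scaler_sumr; apply: eq_bigr => j _.
  by rewrite scalerAl subnDA.
pose F i j := (coef k j *: coef a (i - j)) * coef b (n - i).
transitivity (\sum_(i < n.+1) \sum_(j < i.+1) F i j); last first.
  by apply: eq_bigr => i _; rewrite big_distrl.
rewrite sum_triangle; apply: eq_bigr => i _; apply: eq_bigr => j _.
by rewrite /F addKn.
Qed.

HB.instance Definition _ :=
  GRing.Lmodule_isLalgebra.Build (fps K) (fps A) fps_scaleAl.

Fact fps_scaleAr k a b : k *: (a * b) = a * (k *: b).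
Proof.
apply: fpsP => n; rewrite !fps_scaleE !fps_mulE /=.
pose F i j := (coef a j) * (coef k i *: coef b (n - i - j)).
transitivity (\sum_(i < n.+1) \sum_(j < (n - i).+1) F i j).
  apply: eq_bigr => i _; rewrite scaler_sumr; apply: eq_bigr => j _.
  by rewrite scalerAr.
rewrite sum_triangleC; apply: eq_bigr => j _; rewrite big_distrr /=.
by apply: eq_bigr => i _; rewrite /F subnAC.
Qed.

HB.instance Definition _ :=
  GRing.Lalgebra_isAlgebra.Build (fps K) (fps A) fps_scaleAr.

End FpsAlg.

Section FpsSubst.
Variables (K : fieldType) (A : algType K).
Implicit Types a : fps A.

(* sum_k (f k) a^k, for [a] without constant term: [a ^+ k] then starts at order
   [k], so that only [k <= n] contribute to the coefficient of [xi^n]. *)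
Definition fps_subst (f : nat -> K) a : fps A :=
  Fps (fun n => \sum_(k < n.+1) f k *: coef (a ^+ k) n).

Definition fps_exp a : fps A := fps_subst (fun k => (k`!%:R)^-1) a.

(* The coefficient for [k = 0] vanishes, as [0^-1 = 0]. *)
Definition fps_ln a : fps A :=
  fps_subst (fun k => (-1) ^+ k.+1 / k%:R) (a - 1).

Lemma coef_exp_small a k n : coef a 0 = 0 -> (n < k)%N -> coef (a ^+ k) n = 0.
Proof.
move=> a0; elim: k n => [|k IHk] n // ltnk.
rewrite exprS fps_mulE /= big_ord_recl /= a0 mul0r add0r big1 // => i _.
rewrite IHk ?mulr0 //; case: n ltnk i => [|n] ltnk i; first by case: i.
by rewrite /= subSS (leq_ltn_trans (leq_subr _ _)).
Qed.

Lemma fps_unit a : coef a 0 = 1 -> a \is a GRing.unit.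
Proof.
move=> a0; pose y := 1 - a.
have y0 : coef y 0 = 0 by rewrite /y fps_coefD fps_coefN a0 subrr.
pose G := fps_subst (fun=> 1) y.
have GE n m : (n < m)%N -> coef G n = \sum_(k < m) coef (y ^+ k) n.
  move=> ltnm; rewrite /G /= (big_ord_widen m (fun k => 1 *: coef (y ^+ k) n)) //.
  rewrite big_mkcond /=; apply: eq_bigr => k _; case: ifP => [_|/negbT].
    by rewrite scale1r.
  by rewrite -leqNgt => ?; rewrite coef_exp_small.
have yG : y * G = G - 1.
  apply: fpsP => n; rewrite fps_coefD fps_coefN fps_mulE /=.
  transitivity (\sum_(k < n.+1) coef (y ^+ k.+1) n).
    transitivity (\sum_(i < n.+1) \sum_(k < n.+1)
        coef y i * coef (y ^+ k) (n - i)).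
      apply: eq_bigr => i _; rewrite -[\sum_(k < _) _]/(coef G (n - i)).
      by rewrite (GE _ n.+1) ?ltnS ?leq_subr // big_distrr.
    rewrite exchange_big /=; apply: eq_bigr => k _.
    by rewrite exprS fps_mulE.
  rewrite -[\sum_(k < n.+1) 1 *: _]/(coef G n) (GE n n.+2) //.
  by rewrite [in RHS]big_ord_recl [RHS]addrC addKr.
have Gy : G * y = G - 1.
  apply: fpsP => n; rewrite fps_coefD fps_coefN fps_mulE /=.
  transitivity (\sum_(k < n.+1) coef (y ^+ k.+1) n).
    transitivity (\sum_(i < n.+1) \sum_(k < n.+1)
        coef (y ^+ k) i * coef y (n - i)).
      apply: eq_bigr => i _; rewrite -[\sum_(k < _) _]/(coef G i).
      by rewrite (GE i n.+1) // big_distrl.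
    rewrite exchange_big /=; apply: eq_bigr => k _.
    by rewrite exprSr fps_mulE.
  rewrite -[\sum_(k < n.+1) 1 *: _]/(coef G n) (GE n n.+2) //.
  by rewrite [in RHS]big_ord_recl [RHS]addrC addKr.
have -> : a = 1 - y by rewrite /y opprB addrC subrK.
apply/unitrP; exists G.
by rewrite mulrBr mulrBl mulr1 mul1r yG Gy opprB addrC subrK.
Qed.

Lemma fps_exp_unit a : fps_exp a \is a GRing.unit.
Proof.
by apply: fps_unit; rewrite /= big_ord1 expr0 fact0 invr1 scale1r.
Qed.

End FpsSubst.

Section Universal.
Variable K : fieldType.

(* [iota : g -> U] is the universal enveloping algebra of the Lie algebra [g]
   with bracket [br]. *)
Definition is_enveloping_algebra (g : lmodType K) (br : g -> g -> g)
    (U : algType K) (iota : {linear g -> U}) : Prop :=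
  (forall x y, iota (br x y) = iota x * iota y - iota y * iota x) /\
  forall (A : algType K) (f : {linear g -> A}),
    (forall x y, f (br x y) = f x * f y - f y * f x) ->
    exists phi : {lrmorphism U -> A}, (forall x, phi (iota x) = f x) /\
      forall psi : {lrmorphism U -> A}, (forall x, psi (iota x) = f x) ->
        psi =1 phi.

(* [T], with [tens a b] for a (x) b, is the algebra A (x) B. *)
Definition is_tensor_algebra (A B T : algType K)
    (tens : {bilinear A -> B -> T}) : Prop :=
  [/\ tens 1 1 = 1,
      forall a a' b b', tens a b * tens a' b' = tens (a * a') (b * b') &
      forall (V : lmodType K) (f : {bilinear A -> B -> V}),
        exists g : {linear T -> V}, (forall a b, g (tens a b) = f a b) /\
          forall h : {linear T -> V}, (forall a b, h (tens a b) = f a b) ->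
            h =1 g].

End Universal.

Section SpecialLinear.
Variables (K : fieldType) (N : nat).

Definition sl : {vspace 'M[K]_N} :=
  lker (linfun (mxtrace : 'M[K]_N -> K^o)).

Lemma mem_sl A : (A \in sl) = (\tr A == 0).
Proof. by rewrite memv_ker lfunE. Qed.

(* [vsproj sl] turns a traceless matrix into an element of the type
   [subvs_of sl]; it is only applied to matrices that are traceless. *)
Definition sl_bracket (A B : subvs_of sl) : subvs_of sl :=
  vsproj sl (vsval A *m vsval B - vsval B *m vsval A).

Lemma sl_bracketE A B :
  vsval (sl_bracket A B) = vsval A *m vsval B - vsval B *m vsval A.
Proof.
by rewrite /sl_bracket vsprojK // mem_sl raddfB /= mxtrace_mulC subrr.
Qed.

(* The matrix unit E_ij of gl(N), with indices 1 <= i, j <= N. *)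
Definition munit (i j : nat) : 'M[K]_N :=
  \matrix_(a < N, b < N) ((a.+1 == i) && (b.+1 == j))%:R.

Lemma munit_delta (i j : 'I_N) : munit i.+1 j.+1 = delta_mx i j.
Proof. by apply/matrixP => a b; rewrite !mxE !eqSS. Qed.

Lemma munit_sl i j : i != j -> munit i j \in sl.
Proof.
move=> ij; rewrite mem_sl /mxtrace big1 // => a _; rewrite mxE.
by case: eqP => // ->; rewrite (negPf ij).
Qed.

Lemma munit_diag_sl i j : (0 < i <= N)%N -> (0 < j <= N)%N ->
  munit i i - munit j j \in sl.
Proof.
have tr1 k : (0 < k <= N)%N -> \tr (munit k k) = 1.
  case: k => // k /= ltkN; rewrite /mxtrace (bigD1 (Ordinal ltkN)) //= mxE eqxx.
  rewrite big1 ?addr0 // => a /eqP neq; rewrite mxE andbb eqSS.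
  by case: eqP => // ak; case: neq; apply: val_inj.
by move=> iN jN; rewrite mem_sl raddfB /= !tr1 // subrr.
Qed.

End SpecialLinear.

Section Twist.
Variables (K : fieldType) (N : nat).
Variables (U : algType K) (iota : {linear subvs_of (sl K N) -> U}).
Variables (T : algType K) (tens : {bilinear U -> U -> T}).
Variable Delta : {lrmorphism U -> T}.

Definition uE (i j : nat) : fps U :=
  fps_const (iota (vsproj (sl K N) (munit K N i j))).

Definition uH1N : fps U :=
  fps_const (iota (vsproj (sl K N) (munit K N 1 1 - munit K N N N))).

Definition sigma : fps U :=
  fps_const (2%:R^-1 : K) *: fps_ln (1 + (2%:R * xi) *: uE 1 N).

Definition twist : fps T :=
  fps_exp (fps_conv tens uH1N sigma) *
  \prod_(2 <= j < N)
    fps_exp (fps_conv tens ((2%:R * xi) *: uE 1 j)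
                           (uE j N * fps_exp (- (2%:R * sigma)))).

Lemma twist_unit : twist \is a GRing.unit.
Proof.
rewrite unitrMl ?fps_exp_unit //.
by elim/big_rec: _ => [|j x _ ux]; rewrite ?unitr1 // unitrMl ?fps_exp_unit.
Qed.

(* [fps_map Delta] is the K[[xi]]-linear extension of the coproduct of U. By
   [twist_unit], [twist^-1] is a genuine inverse. *)
Definition twisted_coproduct (a : fps U) : fps T :=
  twist * fps_map Delta a * twist^-1.

End Twist.

Definition antilinear (K : nzRingType) (conj : K -> K) (V W : lmodType K)
    (f : V -> W) : Prop :=
  forall k u v, f (k *: u + v) = conj k *: f u + f v.

Definition is_lie_antiautomorphism (C : numClosedFieldType) (g : lmodType C)
    (br : g -> g -> g) (f : g -> g) : Prop :=
  [/\ antilinear Num.conj f, bijective f &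
      forall a b, f (br a b) = br (f b) (f a)].

Section RealForm.
Variables (C : numClosedFieldType) (U T : algType C).
Variable tens : {bilinear U -> U -> T}.

(* The conjugation of C[[xi]] for which the formal parameter [xi] is real. *)
Definition fps_conj : fps C -> fps C := fps_map Num.conj.

Definition is_antilinear_antihom (Theta : fps U -> fps U) : Prop :=
  [/\ antilinear fps_conj Theta, Theta 1 = 1 &
      forall a b, Theta (a * b) = Theta b * Theta a].

(* [TT] is Theta (x) Theta. Being antilinear over C[[xi]], [TT] is determined by
   its values on (the constant series) a (x) b. *)
Definition is_tensor_square (Theta : fps U -> fps U) (TT : fps T -> fps T) :=
  antilinear fps_conj TT /\
  forall a b, TT (fps_conv tens a b) = fps_conv tens (Theta a) (Theta b).

Definition is_real_form (coprod : fps U -> fps T) (Theta : fps U -> fps U) :=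
  [/\ is_antilinear_antihom Theta,
      exists! TT, is_tensor_square Theta TT &
      forall TT, is_tensor_square Theta TT ->
        forall a, TT (coprod a) = coprod (Theta a)].

End RealForm.

Section Theta.
Variables (C : numClosedFieldType) (N : nat).

Definition theta_unit (i j : nat) : 'M[C]_N :=
  if (i < N)%N && (j < N)%N || (i == N) && (j == N)
  then - munit C N i j else munit C N i j.

(* The antilinear map of gl(N) with value [theta_unit i j] on E_ij. *)
Definition theta (A : 'M[C]_N) : 'M[C]_N :=
  \sum_(i < N) \sum_(j < N) (A i j)^* *: theta_unit i.+1 j.+1.

Definition sl_theta (A : subvs_of (sl C N)) : subvs_of (sl C N) :=
  vsproj (sl C N) (theta (vsval A)).

Definition extends_theta (U : algType C)
    (iota : {linear subvs_of (sl C N) -> U}) (Theta : fps U -> fps U) : Prop :=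
  forall Y, Theta (fps_const (iota Y)) = fps_const (iota (sl_theta Y)).

End Theta.

(* Main.v *)
From HB Require Import structures.
Require Import Defs.
From mathcomp Require Import all_boot all_order all_algebra.
From mathcomp Require Import boolp reals complex ring.

Set Implicit Arguments.
Unset Strict Implicit.
Unset Printing Implicit Defensive.

Import GRing.Theory Num.Theory.

Local Open Scope ring_scope.

(** Writing D = diag(1, ..., 1, -1), the map theta is A |-> - D conj(A) D on
gl(N), hence an involutive antilinear Lie anti-automorphism. Antilinear
anti-homomorphisms U -> U are homomorphisms from U to the conjugate opposite
algebra, so the universal property extends theta to U, and coefficientwise to
U[[xi]]; the same conjugation trick gives theta (x) theta on T[[xi]].
Every exponent X of the twist satisfies (theta (x) theta)(X) = - X: theta
negates H_1N and E_1j, and fixes sigma and E_jN e^(-2 sigma), as E_jN commutes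
with E_1N.
Since theta (x) theta reverses products, it sends F to F^-1, and therefore
F Delta(a) F^-1 to F Delta(theta a) F^-1. *)

(** * Subalgebras and induction on an enveloping algebra *)

Section Subalgebra.
Variables (K : fieldType) (A : algType K) (S : subalgClosed A).

(** The universal property speaks of types with an algebra structure, so a closed predicate has to
    become such a type before it can serve as a target. *)
Record subalgebra := Subalgebra { subalg_val : A; _ : subalg_val \in S }.
HB.instance Definition _ := [isSub for subalg_val].
HB.instance Definition _ := [Choice of subalgebra by <:].
HB.instance Definition _ := [SubChoice_isSubAlgebra of subalgebra by <:].

HB.instance Definition _ := GRing.isLinear.Build K subalgebra A *:%R subalg_val
  (fun _ _ _ => erefl).
HB.instance Definition _ := GRing.isMonoidMorphism.Build subalgebra A subalg_val
  (erefl, fun _ _ => erefl).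

End Subalgebra.

Section Enveloping.
Variables (K : fieldType) (g : lmodType K) (br : g -> g -> g).
Variables (U : algType K) (iota : {linear g -> U}).
Hypothesis U_env : is_enveloping_algebra br iota.

(** The elements satisfying [P] form a subalgebra containing the image of [iota], so [iota] extends
    to a morphism from [U] to it. Followed by the inclusion, this morphism agrees with the identity
    on [iota], hence is the identity by uniqueness. *)
Lemma enveloping_ind (P : U -> Prop) :
    P 1 -> (forall k u v, P u -> P v -> P (k *: u + v)) ->
    (forall u v, P u -> P v -> P (u * v)) -> (forall x, P (iota x)) ->
  forall u, P u.
Proof.
move=> P1 PZD PM Piota.
pose S : {pred U} := fun u => `[< P u >].
have SP u : reflect (P u) (u \in S) by apply: asboolP.
have S_closed : GRing.subalg_closed S.
  by split=> [|k u v|u v]; [exact/SP | |] => /SP Pu /SP Pv; apply/SP; auto.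
pose SF := GRing.isSubalgClosed.Build K U S S_closed.
pose SS : subalgClosed U := HB.pack S SF.
pose f (x : g) : subalgebra SS :=
  Subalgebra (introT (SP _) (Piota x) : iota x \in SS).
have f_lin : linear f by move=> k x y; apply: val_inj; rewrite /= linearP.
pose fF := GRing.isLinear.Build _ _ _ _ f f_lin.
pose fL : {linear g -> subalgebra SS} := HB.pack f fF.
have [iota_br U_univ] := U_env.
have [|phi [phi_iota _]] := U_univ _ fL.
  by move=> x y; apply: val_inj; rewrite /= iota_br.
have [|id' [_ id'_uniq]] := U_univ _ iota; first exact: iota_br.
move=> u.
pose psi : {lrmorphism U -> U} := @subalg_val _ _ SS \o phi.
have psi_iota x : psi (iota x) = iota x by rewrite /= phi_iota.
have -> : u = \val (phi u).
  by rewrite [LHS](id'_uniq idfun) // -(id'_uniq psi psi_iota).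
exact/SP/valP.
Qed.

End Enveloping.

(** * Basic rules for antilinear maps *)

Section Antilinear.
Variables (K : nzRingType) (conj : K -> K) (V W : lmodType K) (f : V -> W).
Hypotheses (conj1 : conj 1 = 1) (f_anti : antilinear conj f).

Lemma antilinearD u v : f (u + v) = f u + f v.
Proof. by rewrite -[u]scale1r f_anti conj1 !scale1r. Qed.

Lemma antilinear0 : f 0 = 0.
Proof. by apply: (@addrI _ (f 0)); rewrite -antilinearD !addr0. Qed.

Lemma antilinearZ k v : f (k *: v) = conj k *: f v.
Proof. by rewrite -[k *: v]addr0 f_anti antilinear0 addr0. Qed.

Lemma antilinearN v : f (- v) = - f v.
Proof. by apply: (@addrI _ (f v)); rewrite -antilinearD !subrr antilinear0. Qed.

Lemma antilinear_sum I (r : seq I) (P : pred I) (F : I -> V) :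
  f (\sum_(i <- r | P i) F i) = \sum_(i <- r | P i) f (F i).
Proof.
by apply: (big_morph f antilinearD antilinear0).
Qed.

End Antilinear.

(** * Conjugate modules and conjugate opposite algebras *)

Section ConjModule.
Variable C : numClosedFieldType.

(** A linear map into the conjugate module is an antilinear map into [V], so universal properties
    stated for linear maps also produce antilinear ones. The alias keeps the two scalar actions on
    the same set apart. *)
Definition conj_module (V : lmodType C) : Type := V.

Section Instances.
Variable V : lmodType C.

HB.instance Definition _ := GRing.Zmodule.copy (conj_module V) V.

Let scale (k : C) (v : conj_module V) : conj_module V := k^* *: (v : V).

Fact conj_scaleA k l v : scale k (scale l v) = scale (k * l) v.
Proof. by rewrite /scale scalerA rmorphM. Qed.
Fact conj_scale1 : left_id 1 scale.
Proof. by move=> v; rewrite /scale rmorph1 scale1r. Qed.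
Fact conj_scaleDr : right_distributive scale +%R.
Proof. by move=> k u v; rewrite /scale scalerDr. Qed.
Fact conj_scaleDl v : {morph scale^~ v : k l / k + l}.
Proof. by move=> k l; rewrite /scale rmorphD scalerDl. Qed.

HB.instance Definition _ := GRing.Zmodule_isLmodule.Build C (conj_module V)
  conj_scaleA conj_scale1 conj_scaleDr conj_scaleDl.

End Instances.

(** With the product reversed too, an algebra morphism [A -> conj_opposite A] is an antilinear
    anti-homomorphism of [A]. *)
Definition conj_opposite (A : algType C) : Type := A.

Section OppositeInstances.
Variable A : algType C.

HB.instance Definition _ := GRing.NzRing.copy (conj_opposite A) A^c.
HB.instance Definition _ :=
  GRing.Zmodule_isLmodule.Build C (conj_opposite A)
    (@conj_scaleA A) (@conj_scale1 A) (@conj_scaleDr A) (@conj_scaleDl A).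

Fact conj_opp_scaleAl k (a b : conj_opposite A) : k *: (a * b) = (k *: a) * b.
Proof. exact: (@scalerAr C A k^* b a). Qed.
HB.instance Definition _ :=
  GRing.Lmodule_isLalgebra.Build C (conj_opposite A) conj_opp_scaleAl.

Fact conj_opp_scaleAr k (a b : conj_opposite A) : k *: (a * b) = a * (k *: b).
Proof. exact: (@scalerAl C A k^* b a). Qed.
HB.instance Definition _ :=
  GRing.Lalgebra_isAlgebra.Build C (conj_opposite A) conj_opp_scaleAr.

End OppositeInstances.

Definition antilinear_antihom (A : algType C) (f : A -> A) : Prop :=
  [/\ antilinear Num.conj f, f 1 = 1 & forall a b, f (a * b) = f b * f a].

(** The map [t] reverses the bracket and the target reverses the product. The two reversals cancel,
    so [iota] after [t] sends brackets to commutators of [conj_opposite U]. *)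
Lemma enveloping_antihom (g : lmodType C) (br : g -> g -> g)
    (U : algType C) (iota : {linear g -> U}) (t : g -> g) :
    is_enveloping_algebra br iota -> antilinear Num.conj t ->
    (forall x y, t (br x y) = br (t y) (t x)) ->
  exists2 t' : U -> U, antilinear_antihom t' &
    forall x, t' (iota x) = iota (t x).
Proof.
move=> [iota_br U_univ] t_anti t_br.
pose f (x : g) : conj_opposite U := iota (t x).
have f_lin : linear f by move=> k x y; rewrite /f t_anti linearP.
pose fF := GRing.isLinear.Build _ _ _ _ f f_lin.
pose fL : {linear g -> conj_opposite U} := HB.pack f fF.
have [|phi [phi_iota _]] := U_univ _ fL.
  by move=> x y; rewrite /= /f t_br iota_br.
exists (phi : U -> U) => //; split=> [k u v||a b].
- exact: (linearP phi).
- exact: (rmorph1 phi).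
- exact: (rmorphM phi).
Qed.

End ConjModule.

(** * Antilinear maps on a tensor product of algebras *)

Section TensorAlgebra.
Variables (C : numClosedFieldType) (A B T : algType C).
Variable tens : {bilinear A -> B -> T}.
Hypothesis T_tens : is_tensor_algebra tens.

(** Both maps factor the same bilinear map [m], and such a factorization is unique. *)
Lemma tensor_linear_ext (V : lmodType C) (f h : {linear T -> V}) :
  (forall a b, f (tens a b) = h (tens a b)) -> f =1 h.
Proof.
move=> fh; have [_ _ T_univ] := T_tens.
pose m a b := f (tens a b).
have m_bil : bilinear_for *:%R *:%R m.
  by split=> [b k a a'|a k b b']; rewrite /m ?linearPl ?linearPr linearP.
pose mF := bilinear_isBilinear.Build _ _ _ _ _ _ m m_bil.
pose mB : {bilinear A -> B -> V} := HB.pack m mF.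
have [d [_ d_uniq]] := T_univ _ mB.
by move=> t; rewrite (d_uniq f) // (d_uniq h) // => a b; rewrite /= /m fh.
Qed.

Lemma tensor_antilinear_ext (V : lmodType C) (f h : T -> V) :
    antilinear Num.conj f -> antilinear Num.conj h ->
  (forall a b, f (tens a b) = h (tens a b)) -> f =1 h.
Proof.
move=> f_anti h_anti fh.
pose fF := GRing.isLinear.Build C T (conj_module V) *:%R f f_anti.
pose fL : {linear T -> conj_module V} := HB.pack (f : T -> conj_module V) fF.
pose hF := GRing.isLinear.Build C T (conj_module V) *:%R h h_anti.
pose hL : {linear T -> conj_module V} := HB.pack (h : T -> conj_module V) hF.
exact: (@tensor_linear_ext _ fL hL fh).
Qed.

Lemma tensor_antilinear_map (f : A -> A) (h : B -> B) :
    antilinear Num.conj f -> antilinear Num.conj h ->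
  exists2 fh : T -> T, antilinear Num.conj fh &
    forall a b, fh (tens a b) = tens (f a) (h b).
Proof.
move=> f_anti h_anti; have [_ _ T_univ] := T_tens.
pose m a b : conj_module T := tens (f a) (h b).
have m_bil : bilinear_for *:%R *:%R m.
  split=> [b k a a'|a k b b'].
    by rewrite /m f_anti linearPl.
  by rewrite /m h_anti linearPr.
pose mF := bilinear_isBilinear.Build _ _ _ _ _ _ m m_bil.
pose mB : {bilinear A -> B -> conj_module T} := HB.pack m mF.
have [d [d_tens _]] := T_univ _ mB.
by exists (d : T -> T) => // k u v; apply: (linearP d).
Qed.

Lemma tensor_antihom (f : A -> A) (h : B -> B) (fh : T -> T) :
    antilinear_antihom f -> antilinear_antihom h -> antilinear Num.conj fh ->
    (forall a b, fh (tens a b) = tens (f a) (h b)) ->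
  antilinear_antihom fh.
Proof.
move=> [f_anti f1 fM] [h_anti h1 hM] fh_anti fh_tens.
have [tens1 tensM _] := T_tens; split=> //.
  by rewrite -tens1 fh_tens f1 h1.
(* For fixed [t] both sides are antilinear in [s], and then in [t] for [s] a pure tensor, so
   multiplicativity need only be checked on pure tensors. *)
move=> s t; move: s.
apply: tensor_antilinear_ext => [k u v|k u v|a b].
- by rewrite mulrDl -scalerAl fh_anti.
- by rewrite fh_anti mulrDr scalerAr.
move: t; apply: tensor_antilinear_ext => [k u v|k u v|a' b'].
- by rewrite mulrDr -scalerAr fh_anti.
- by rewrite fh_anti mulrDl scalerAl.
by rewrite tensM !fh_tens fM hM tensM.
Qed.

End TensorAlgebra.

(** * Constant series and coefficientwise extension of maps *)

Section PowerSeries.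
Lemma fps_conv_const (A B V : zmodType) (op : A -> B -> V) x y :
    (forall b, op 0 b = 0) -> (forall a, op a 0 = 0) ->
  fps_conv op (fps_const x) (fps_const y) = fps_const (op x y).
Proof.
move=> op0l op0r; apply: fpsP => -[|n] /=; first by rewrite big_ord1.
rewrite big_ord_recl /= op0r add0r big1 // => i _; exact: op0l.
Qed.

Lemma coef0_conv (A B : Type) (V : zmodType) (op : A -> B -> V) a b :
  coef (fps_conv op a b) 0 = op (coef a 0) (coef b 0).
Proof. by rewrite /= big_ord1. Qed.

Lemma fps_constM (A : nzRingType) (x y : A) :
  fps_const (x * y) = fps_const x * fps_const y.
Proof. by rewrite fps_mulE fps_conv_const // => a; rewrite (mul0r, mulr0). Qed.

Lemma fps_constZ (K : nzRingType) (V : lmodType K) k (v : V) :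
  fps_const (k *: v) = fps_const k *: fps_const v.
Proof.
by rewrite fps_scaleE fps_conv_const // => a; rewrite (scale0r, scaler0).
Qed.

Lemma fps_constD (V : zmodType) (u v : V) :
  fps_const (u + v) = fps_const u + fps_const v.
Proof. by apply: fpsP => -[|n] /=; rewrite ?fps_coefD //= addr0. Qed.

Lemma fps_constN (V : zmodType) (v : V) : fps_const (- v) = - fps_const v.
Proof. by apply: fpsP => -[|n] /=; rewrite ?fps_coefN //= oppr0. Qed.

Lemma coef_scale0 (K : nzRingType) (V : lmodType K) (k : fps K) (v : fps V) :
  coef (k *: v) 0 = coef k 0 *: coef v 0.
Proof. exact: coef0_conv. Qed.

Definition fps_behead (A : Type) (a : fps A) : fps A :=
  Fps (fun n => coef a n.+1).

Lemma coef_xi_scaleS (K : nzRingType) (V : lmodType K) (v : fps V) n :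
  coef (@xi K *: v) n.+1 = coef v n.
Proof.
rewrite fps_scaleE /= !big_ord_recl /= scale0r add0r scale1r big1 ?addr0 //.
  by rewrite subSS subn0.
by move=> i _; rewrite scale0r.
Qed.

Lemma fps_beheadK (K : nzRingType) (V : lmodType K) (v : fps V) :
  @xi K *: fps_behead v + fps_const (coef v 0) = v.
Proof.
apply: fpsP => -[|n]; rewrite fps_coefD.
  by rewrite coef_scale0 scale0r add0r.
by rewrite coef_xi_scaleS /= addr0.
Qed.

Lemma fps_conj_xi (C : numClosedFieldType) : fps_conj xi = xi :> fps C.
Proof. by apply: fpsP => n /=; rewrite rmorph_nat. Qed.

Lemma fps_conj1 (C : numClosedFieldType) : fps_conj 1 = 1 :> fps C.
Proof. by apply: fpsP => -[|n] /=; rewrite (rmorph1, rmorph0). Qed.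

Section AntilinearMaps.
Variables (C : numClosedFieldType) (V W : lmodType C).

Lemma fps_map_antilinear (f : V -> W) :
  antilinear Num.conj f -> antilinear (@fps_conj C) (fps_map f).
Proof.
move=> f_anti k u v; apply: fpsP => n; have c1 := rmorph1 (@Num.conj C).
rewrite fps_coefD /= (antilinearD c1 f_anti) (antilinear_sum c1 f_anti).
by congr (_ + _); apply: eq_bigr => i _; rewrite (antilinearZ c1 f_anti).
Qed.

(* Antilinearity over C[[xi]] forces xi-adic continuity: peel off the constant
   term and divide the rest by xi. *)
Lemma antilinear_fps_ext (F G : fps V -> fps W) :
    antilinear (@fps_conj C) F -> antilinear (@fps_conj C) G ->
  (forall v, F (fps_const v) = G (fps_const v)) -> F =1 G.
Proof.
move=> F_anti G_anti FG a; apply: fpsP => n.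
elim: n a => [|n IHn] a; rewrite -(fps_beheadK a) F_anti G_anti FG fps_conj_xi.
  by rewrite !fps_coefD !coef_scale0 !scale0r.
by rewrite !fps_coefD !coef_xi_scaleS IHn.
Qed.

End AntilinearMaps.

Lemma fps_map_const (V W : zmodType) (f : V -> W) v :
  f 0 = 0 -> fps_map f (fps_const v) = fps_const (f v).
Proof. by move=> f0; apply: fpsP => -[|n]. Qed.

Lemma fps_map_conv (A B A' B' V W : zmodType) (op : A -> B -> V)
    (op' : A' -> B' -> W) (f : A -> A') (h : B -> B') (fh : V -> W) a b :
    fh 0 = 0 -> {morph fh : u v / u + v} ->
    (forall x y, fh (op x y) = op' (f x) (h y)) ->
  fps_map fh (fps_conv op a b) = fps_conv op' (fps_map f a) (fps_map h b).
Proof.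
move=> fh0 fhD fh_op; apply: fpsP => n /=.
by rewrite (big_morph fh fhD fh0); apply: eq_bigr => i _.
Qed.

Lemma fps_map_antihom (C : numClosedFieldType) (A : algType C) (f : A -> A) :
  antilinear_antihom f -> is_antilinear_antihom (fps_map f).
Proof.
move=> [f_anti f1 fM]; have c1 := rmorph1 (@Num.conj C).
split=> [||a b]; first exact: fps_map_antilinear.
  by rewrite fps_oneE fps_map_const ?f1 ?(antilinear0 c1 f_anti).
apply: fpsP => n; rewrite !fps_mulE /= (antilinear_sum c1 f_anti).
(* Swapping the factors of a Cauchy product exchanges the indices [i] and [n - i]. *)
rewrite (reindex_inj rev_ord_inj) /=; apply: eq_bigr => i _.
by rewrite fM subSS subKn // -ltnS.
Qed.

End PowerSeries.

(** * Substitution into power series, exponential and logarithm *)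

Section Substitution.
Variables (K : fieldType) (A : algType K).
Implicit Types (f : nat -> K) (a b : fps A).

(** The powers beyond [n] contribute nothing to the coefficient of index [n]. The free bound [m]
    lets sums for different coefficients share one range, so that they can be exchanged. *)
Lemma coef_subst f a n m : coef a 0 = 0 -> (n < m)%N ->
  coef (fps_subst f a) n = \sum_(k < m) f k *: coef (a ^+ k) n.
Proof.
move=> a0 ltnm.
rewrite /= (big_ord_widen m (fun k => f k *: coef (a ^+ k) n)) //.
rewrite big_mkcond /=; apply: eq_bigr => k _; case: ifP => // /negbT.
by rewrite -leqNgt => ?; rewrite coef_exp_small // scaler0.
Qed.

(** Substituting [a] is multiplicative: the terms [a ^+ k * a ^+ l] are grouped by their total
    degree [s = k + l]. *)
Lemma fps_substM f g a : coef a 0 = 0 ->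
  fps_subst f a * fps_subst g a = fps_subst (coef (Fps f * Fps g)) a.
Proof.
move=> a0; apply: fpsP => n; rewrite [RHS]/=.
rewrite -[LHS]/(\sum_(i < n.+1)
  coef (fps_subst f a) i * coef (fps_subst g a) (n - i)).
transitivity (\sum_(i < n.+1) \sum_(k < n.+1) \sum_(l < n.+1)
    (f k * g l) *: (coef (a ^+ k) i * coef (a ^+ l) (n - i))).
  apply: eq_bigr => i _.
  rewrite (@coef_subst f a i n.+1) //.
  rewrite (@coef_subst g a _ n.+1) ?ltnS ?leq_subr //.
  rewrite big_distrl /=; apply: eq_bigr => k _.
  rewrite big_distrr /=; apply: eq_bigr => l _.
  by rewrite -scalerAl -scalerAr scalerA.
pose F s k := (f k * g (s - k)%N) *: coef (a ^+ s) n.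
transitivity (\sum_(s < n.+1) \sum_(k < s.+1) F s k); last first.
  by apply: eq_bigr => s _; rewrite -scaler_suml.
rewrite sum_triangle exchange_big /=; apply: eq_bigr => k _.
rewrite exchange_big /=.
transitivity (\sum_(l < n.+1) F (k + l)%N k).
  apply: eq_bigr => l _.
  by rewrite /F addKn exprD fps_mulE /= scaler_sumr.
(* The range of [l] is enlarged to a full square. The added terms have [k + l > n], where the
   coefficient of index [n] of [a ^+ (k + l)] is zero. *)
rewrite [RHS](big_ord_widen n.+1 (fun l => F (k + l)%N k)) ?ltnS ?leq_subr //.
rewrite [RHS]big_mkcond /=; apply: eq_bigr => l _; case: ifP => // /negbT.
rewrite -leqNgt ltn_subLR ?leq_ord // => lt_n_kl.
by rewrite /F coef_exp_small ?scaler0.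
Qed.

Lemma fps_subst_comm f a b : coef a 0 = 0 -> GRing.comm b a ->
  GRing.comm b (fps_subst f a).
Proof.
move=> a0 ba; apply: fpsP => n.
transitivity (\sum_(k < n.+1) f k *: coef (b * a ^+ k) n).
  transitivity (\sum_(i < n.+1) \sum_(k < n.+1)
      f k *: (coef b i * coef (a ^+ k) (n - i))).
    apply: eq_bigr => i _; rewrite (@coef_subst f a _ n.+1) ?ltnS ?leq_subr //.
    by rewrite big_distrr /=; apply: eq_bigr => k _; rewrite -scalerAr.
  by rewrite exchange_big; apply: eq_bigr => k _; rewrite -scaler_sumr.
transitivity (\sum_(i < n.+1) \sum_(k < n.+1)
    f k *: (coef (a ^+ k) i * coef b (n - i))).
  rewrite exchange_big; apply: eq_bigr => k _.
  by rewrite (commrX k ba) -scaler_sumr.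
apply: eq_bigr => i _; rewrite (@coef_subst f a i n.+1) //.
by rewrite big_distrl /=; apply: eq_bigr => k _; rewrite -scalerAl.
Qed.

Lemma coef0_fps_ln a : coef (fps_ln a) 0 = 0.
Proof. by rewrite /= big_ord1 invr0 mulr0 scale0r. Qed.

End Substitution.

(** Both factors are series in [a], so the identity reduces to one between scalar coefficients:
    those of the product are [(1 - 1) ^+ s / s!]. *)
Lemma fps_expN (K : numFieldType) (A : algType K) (a : fps A) :
  coef a 0 = 0 -> fps_exp a * fps_exp (- a) = 1.
Proof.
move=> a0.
have -> : fps_exp (- a) = fps_subst (fun k => (-1) ^+ k / k`!%:R) a.
  apply: fpsP => n /=; apply: eq_bigr => k _.
  rewrite (exprNn a) -(signr_odd K k) -(signr_odd (fps A) k) !mulr_sign.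
  by case: (odd k); rewrite // fps_coefN scalerN scaleNr.
rewrite fps_substM //.
have fact_neq0 m : m`!%:R != 0 :> K by rewrite pnatr_eq0 -lt0n fact_gt0.
apply: fpsP => n; rewrite -[RHS]/(coef (a ^+ 0) n) [LHS]/= big_ord_recl.
rewrite /= big_ord1 expr0 fact0 invr1 !mulr1 scale1r big1 ?addr0 // => i _.
rewrite /bump add1n; set s := (i.+1); suff -> : \sum_(k < s.+1)
  (k`!%:R^-1 * ((-1) ^+ (s - k) / (s - k)`!%:R)) = 0 :> K by rewrite scale0r.
(* After multiplication by the factorial of [s], the sum is the binomial expansion of
   [(1 - 1) ^+ s], which is zero since [s] is positive. *)
apply: (mulfI (fact_neq0 s)); rewrite mulr0.
transitivity ((1 - 1) ^+ s : K); last by rewrite subrr expr0n.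
rewrite addrC exprDn big_distrr /=; apply: eq_bigr => k _.
rewrite expr1n mulr1 -(bin_fact (leq_ord k)) natrM natrM.
rewrite -[RHS]mulr_natr; field.
by rewrite !fact_neq0.
Qed.

Section RealSubstitution.
Variables (C : numClosedFieldType) (A : algType C) (t : A -> A).
Hypothesis t_antihom : antilinear_antihom t.

(** Reversal of products does not affect the powers of a single element, and conjugation does not
    affect real coefficients. *)
Lemma fps_map_subst (f : nat -> C) a : (forall k, (f k)^* = f k) ->
  fps_map t (fps_subst f a) = fps_subst f (fps_map t a).
Proof.
move=> f_real; have [t_anti _ _] := t_antihom.
have [_ T1 TM] := fps_map_antihom t_antihom.
have TX k : fps_map t (a ^+ k) = fps_map t a ^+ k.
  by elim: k => [|k IHk]; rewrite ?expr0 // exprS TM IHk -exprSr.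
have c1 := rmorph1 (@Num.conj C).
apply: fpsP => n /=; rewrite (antilinear_sum c1 t_anti); apply: eq_bigr => k _.
by rewrite (antilinearZ c1 t_anti) -TX -[in RHS]f_real.
Qed.

Lemma fps_map_exp a : fps_map t (fps_exp a) = fps_exp (fps_map t a).
Proof. by apply: fps_map_subst => k; rewrite fmorphV rmorph_nat. Qed.

Lemma fps_map_ln a : fps_map t (fps_ln a) = fps_ln (fps_map t a).
Proof.
have [T_anti T1 _] := fps_map_antihom t_antihom; have c1 := fps_conj1 C.
rewrite /fps_ln fps_map_subst => [|k].
  by rewrite (antilinearD c1 T_anti) (antilinearN c1 T_anti) T1.
by rewrite rmorphM fmorphV rmorph_nat rmorphXn rmorphN rmorph1.
Qed.

End RealSubstitution.

(** * The map theta on matrices and on sl(N) *)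

Section Theta.
Variables (C : numClosedFieldType) (N : nat).

(** The matrix D = diag(1, ..., 1, -1). Ordinals start at 0, so the last diagonal entry is the one
    with [i.+1 == N]. *)
Definition theta_sign : 'M[C]_N :=
  diag_mx (\row_(i < N) (if i.+1 == N then -1 else 1)).

Let ltn_ordS (k : 'I_N) : (k.+1 < N)%N = (k.+1 != N).
Proof. by rewrite ltn_neqAle ltn_ord andbT. Qed.

Lemma theta_signK : theta_sign *m theta_sign = 1%:M.
Proof.
rewrite /theta_sign mulmx_diag -diag_const_mx; congr diag_mx.
by apply/rowP => i; rewrite !mxE; case: ifP => _; rewrite ?mulrNN mulr1.
Qed.

(** Conjugation by D changes the sign of an entry exactly when one, but not both, of its indices is
    [N]. The outer sign then gives the values of [theta_unit]. *)
Lemma theta_conjE A :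
  theta A = - (theta_sign *m map_mx Num.conj A *m theta_sign).
Proof.
rewrite [RHS]matrix_sum_delta; apply: eq_bigr => i _; apply: eq_bigr => j _.
rewrite /theta_sign mul_mx_diag mul_diag_mx /theta_unit munit_delta !mxE.
rewrite !ltn_ordS; case: (i.+1 == N); case: (j.+1 == N);
  rewrite /= ?scalerN -?scaleNr;
  by congr (_ *: _); rewrite ?mulN1r ?mulrN1 ?mul1r ?mulr1 ?opprK.
Qed.

(** No bound on [i] and [j] is required: for indices outside 1, ..., N the matrix unit is zero and
    both sides vanish. *)
Lemma theta_munit i j : theta (munit C N i j) = theta_unit C N i j.
Proof.
have munit_conj : map_mx Num.conj (munit C N i j) = munit C N i j.
  by apply/matrixP => x y; rewrite !mxE rmorph_nat.
rewrite theta_conjE munit_conj /theta_sign mul_mx_diag mul_diag_mx.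
apply/matrixP => x y; rewrite /theta_unit (fun_if (fun M : 'M_N => M x y)) !mxE.
have [xi|_] := eqVneq x.+1 i; have [yj|_] := eqVneq y.+1 j;
  rewrite /= ?mulr0 ?mul0r ?oppr0 ?if_same //.
rewrite -xi -yj !ltn_ordS.
by case: (x.+1 == N); case: (y.+1 == N);
  rewrite /= ?mulN1r ?mulrN1 ?mul1r ?mulr1 ?opprK.
Qed.

Lemma theta_antilinear : antilinear Num.conj (@theta C N).
Proof.
move=> k A B; rewrite !theta_conjE map_mxD map_mxZ mulmxDr mulmxDl opprD.
by rewrite -scalemxAr -scalemxAl scalerN.
Qed.

(** The two inner factors D cancel. On matrices theta thus keeps the order of a product, and it is
    the sign that makes it reverse commutators. *)
Lemma thetaM (A B : 'M[C]_N) : theta (A *m B) = - (theta A *m theta B).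
Proof.
rewrite !theta_conjE mulNmx mulmxN opprK map_mxM; congr (- _).
by rewrite !mulmxA -(mulmxA _ theta_sign theta_sign) theta_signK mulmx1.
Qed.

Lemma thetaK : involutive (@theta C N).
Proof.
move=> A; rewrite !theta_conjE raddfN /= !map_mxM mulmxN mulNmx opprK.
have -> : map_mx Num.conj theta_sign = theta_sign.
  rewrite /theta_sign map_diag_mx; congr diag_mx; apply/rowP => i.
  by rewrite !mxE; case: ifP => _; rewrite ?rmorphN rmorph1.
have -> : map_mx Num.conj (map_mx Num.conj A) = A.
  by apply/matrixP => i j; rewrite !mxE conjCK.
by rewrite !mulmxA theta_signK mul1mx -mulmxA theta_signK mulmx1.
Qed.

(** By cyclicity of the trace and D^2 = 1, theta turns the trace into minus its conjugate. *)
Lemma theta_sl A : A \in sl C N -> theta A \in sl C N.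
Proof.
rewrite !mem_sl theta_conjE raddfN /= mxtrace_mulC mulmxA theta_signK mul1mx.
by rewrite trace_map_mx oppr_eq0 fmorph_eq0.
Qed.

Lemma val_sl_theta A : vsval (@sl_theta C N A) = theta (vsval A).
Proof. by rewrite vsprojK // theta_sl // subvsP. Qed.

Lemma sl_theta_antiautomorphism :
  is_lie_antiautomorphism (@sl_bracket C N) (@sl_theta C N).
Proof.
split=> [k A B||A B].
- by apply: subvs_inj; rewrite val_sl_theta /= theta_antilinear !val_sl_theta.
(* As an involution, the map is its own inverse. *)
- by exists (@sl_theta C N) => A;
    apply: subvs_inj; rewrite !val_sl_theta thetaK.
have c1 := rmorph1 (@Num.conj C); apply: subvs_inj.
rewrite val_sl_theta !sl_bracketE !val_sl_theta.
rewrite (antilinearD c1 theta_antilinear).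
by rewrite (antilinearN c1 theta_antilinear) !thetaM opprK addrC.
Qed.

Lemma sl_theta_vsproj (A : 'M[C]_N) : A \in sl C N ->
  sl_theta (vsproj (sl C N) A) = vsproj (sl C N) (theta A).
Proof. by move=> slA; rewrite /sl_theta vsprojK. Qed.

End Theta.

(** * Action of theta on the twist and on the twisted coproduct *)

Section TwistedCoproduct.
Variables (C : numClosedFieldType) (N : nat).
Hypothesis N_ge2 : (2 <= N)%N.
Variables (U : algType C) (iota : {linear subvs_of (sl C N) -> U}).
Hypothesis U_env : is_enveloping_algebra (@sl_bracket C N) iota.
Variables (T : algType C) (tens : {bilinear U -> U -> T}).
Variable Delta : {lrmorphism U -> T}.
Hypothesis Delta_prim :
  forall Y, Delta (iota Y) = tens (iota Y) 1 + tens 1 (iota Y).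
Variables (t : U -> U) (tsq : T -> T).
Hypothesis t_antihom : antilinear_antihom t.
Hypothesis t_iota : forall Y, t (iota Y) = iota (sl_theta Y).
Hypothesis tsq_antihom : antilinear_antihom tsq.
Hypothesis tsq_tens : forall a b, tsq (tens a b) = tens (t a) (t b).

Let c1 := rmorph1 (@Num.conj C).
Let fc1 := fps_conj1 C.

Let t_const v : fps_map t (fps_const v) = fps_const (t v).
Proof. by apply: fps_map_const; case: t_antihom => /(antilinear0 c1). Qed.

Let t_anti : antilinear (@fps_conj C) (fps_map t).
Proof. by case: (fps_map_antihom t_antihom). Qed.

Let tM a b : fps_map t (a * b) = fps_map t b * fps_map t a.
Proof. by case: (fps_map_antihom t_antihom). Qed.

Let tsqM a b : fps_map tsq (a * b) = fps_map tsq b * fps_map tsq a.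
Proof. by case: (fps_map_antihom tsq_antihom). Qed.

Let tsq1 : fps_map tsq 1 = 1.
Proof. by case: (fps_map_antihom tsq_antihom). Qed.

Lemma fps_map_tens a b :
  fps_map tsq (fps_conv tens a b) = fps_conv tens (fps_map t a) (fps_map t b).
Proof.
have [tsq_anti _ _] := tsq_antihom; apply: fps_map_conv => //.
  exact: antilinear0 c1 tsq_anti.
exact: antilinearD c1 tsq_anti.
Qed.

Lemma fps_conv_tensNl a b : fps_conv tens (- a) b = - fps_conv tens a b.
Proof.
apply: fpsP => n; rewrite fps_coefN /= -sumrN; apply: eq_bigr => i _.
by rewrite linearNl.
Qed.

(** For distinct indices the matrix unit is traceless, so the projection in [uE] leaves it
    unchanged. *)
Lemma fps_map_uE i j : i != j ->
  fps_map t (uE iota i j) =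
  if (i < N)%N && (j < N)%N || (i == N) && (j == N)
  then - uE iota i j else uE iota i j.
Proof.
move=> ij; rewrite t_const t_iota sl_theta_vsproj ?munit_sl // theta_munit.
by rewrite /theta_unit; case: ifP => _ //; rewrite !raddfN fps_constN.
Qed.

Lemma fps_map_uE1N : fps_map t (uE iota 1 N) = uE iota 1 N.
Proof.
have N1 : 1%N != N by rewrite ltn_eqF.
by rewrite fps_map_uE // ltnn andbF (negPf N1).
Qed.

Lemma fps_map_uH : fps_map t (uH1N iota) = - uH1N iota.
Proof.
have N0 : (0 < N)%N by apply: ltnW.
rewrite t_const t_iota sl_theta_vsproj ?munit_diag_sl ?leqnn ?N0 //.
rewrite (antilinearD c1 (@theta_antilinear C N)).
rewrite (antilinearN c1 (@theta_antilinear C N)) !theta_munit /theta_unit.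
by rewrite N_ge2 ltnn eqxx /= -opprD !raddfN fps_constN.
Qed.

Lemma fps_conj_2xi : fps_conj (2%:R * xi) = 2%:R * xi :> fps C.
Proof.
rewrite mulr_natl mulr2n; apply: fpsP => n /=.
by rewrite rmorphD /= rmorph_nat.
Qed.

Lemma coef0_2xi_scale (V : lmodType C) (v : fps V) :
  coef ((2%:R * xi) *: v) 0 = 0.
Proof. by rewrite coef_scale0 fps_mulE coef0_conv /= mulr0 scale0r. Qed.

Lemma coef0_sigma : coef (sigma iota) 0 = 0.
Proof. by rewrite coef_scale0 coef0_fps_ln scaler0. Qed.

(** The series sigma has real coefficients, counting xi as real, in the fixed element E_1N. *)
Lemma fps_map_sigma : fps_map t (sigma iota) = sigma iota.
Proof.
rewrite /sigma (antilinearZ fc1 t_anti) (fps_map_ln t_antihom).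
rewrite (antilinearD fc1 t_anti) (antilinearZ fc1 t_anti) fps_map_uE1N.
rewrite fps_conj_2xi; case: (fps_map_antihom t_antihom) => _ -> _.
congr (_ *: _); apply: fpsP => -[|n] /=; rewrite ?rmorph0 //.
by rewrite fmorphV rmorph_nat.
Qed.

Lemma coef0_2sigma : coef (- (2%:R * sigma iota)) 0 = 0.
Proof. by rewrite fps_coefN fps_mulE coef0_conv coef0_sigma mulr0 oppr0. Qed.

Lemma fps_map_exp2sigma :
  fps_map t (fps_exp (- (2%:R * sigma iota))) = fps_exp (- (2%:R * sigma iota)).
Proof.
rewrite (fps_map_exp t_antihom) (antilinearN fc1 t_anti) mulr_natl mulr2n.
by rewrite (antilinearD fc1 t_anti) fps_map_sigma.
Qed.

(** Both matrix products E_ij E_kl and E_kl E_ij vanish, hence so does the bracket, whose image in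
    [U] is the commutator. *)
Lemma uE_comm i j k l : i != j -> k != l -> j != k -> i != l ->
  GRing.comm (uE iota i j) (uE iota k l).
Proof.
move=> ij kl jk il; rewrite /GRing.comm -!fps_constM; congr fps_const.
apply/eqP; rewrite -subr_eq0; have [<- _] := U_env.
have munitM0 (a b c d : nat) : b != c -> munit C N a b *m munit C N c d = 0.
  move=> bc; apply/matrixP => x y; rewrite !mxE big1 // => z _; rewrite !mxE.
  have [zb|_] := eqVneq z.+1 b; last by rewrite andbF mul0r.
  by rewrite zb (negPf bc) mulr0.
rewrite eq_sym in il.
rewrite /sl_bracket !vsprojK ?munit_sl // !munitM0 // subrr.
by rewrite !raddf0.
Qed.

(** E_jN commutes with E_1N, hence with sigma as a series in E_1N, and hence with a series in
    sigma. *)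
Lemma uE_comm_exp2sigma j : j != 1%N -> j != N ->
  GRing.comm (uE iota j N) (fps_exp (- (2%:R * sigma iota))).
Proof.
move=> j1 jN; have N1 : 1%N != N by rewrite ltn_eqF.
have commZ k (a b : fps U) : GRing.comm a b -> GRing.comm a (k *: b).
  by rewrite /GRing.comm -scalerAl -scalerAr => ->.
apply: fps_subst_comm coef0_2sigma _; apply: commrN; apply: commrM.
  exact: commr_nat.
apply: (commZ); apply: fps_subst_comm.
  by rewrite addrC addKr coef0_2xi_scale.
by rewrite addrC addKr; apply/commZ/uE_comm => //; rewrite eq_sym.
Qed.

Lemma twist_fps_map : twist iota tens * fps_map tsq (twist iota tens) = 1.
Proof.
(* Since [fps_map tsq] reverses products, this property passes to products of possibly non-commuting
   factors, so each exponential of the twist can be treated alone. *)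
pose inv_fixed x := x * fps_map tsq x = 1.
have inv_fixedM x y : inv_fixed x -> inv_fixed y -> inv_fixed (x * y).
  by rewrite /inv_fixed tsqM => x1 y1; rewrite mulrA -(mulrA x) y1 mulr1.
have inv_fixed_exp x :
      coef x 0 = 0 -> fps_map tsq x = - x -> inv_fixed (fps_exp x).
  by move=> x0 tx; rewrite /inv_fixed (fps_map_exp tsq_antihom) tx fps_expN.
apply: (inv_fixedM).
  apply: (inv_fixed_exp); first by rewrite coef0_conv coef0_sigma linear0r.
  by rewrite fps_map_tens fps_map_uH fps_map_sigma fps_conv_tensNl.
(* The bounds on [j] are kept in the induction: they decide the signs of E_1j and E_jN. *)
rewrite big_nat_cond; elim/big_rec: _ => [|j x].
  by rewrite /inv_fixed tsq1 mulr1.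
rewrite andbT => /andP[j_ge2 j_ltN]; apply: (inv_fixedM).
have j1 : j != 1%N by rewrite gtn_eqF.
have jN : j != N by rewrite ltn_eqF.
apply: (inv_fixed_exp); first by rewrite coef0_conv coef0_2xi_scale linear0l.
rewrite fps_map_tens -fps_conv_tensNl (antilinearZ fc1 t_anti) fps_conj_2xi.
(* The sign comes from E_1j alone. The second tensor factor comes out with its two fixed factors
   swapped, and their commutation restores the order. *)
rewrite fps_map_uE 1?eq_sym // N_ge2 j_ltN /= scalerN tM fps_map_exp2sigma.
by rewrite fps_map_uE // ltnn andbF (negPf jN) /= -uE_comm_exp2sigma.
Qed.

(** Both sides are antilinear and reverse products in [u], so the generators [iota Y] suffice. There
    the equality follows from primitivity and [t 1 = 1]. *)
Lemma tsq_Delta u : tsq (Delta u) = Delta (t u).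
Proof.
have [t_anti0 t1 tM0] := t_antihom; have [tsq_anti tsq10 tsqM0] := tsq_antihom.
move: u; apply: (enveloping_ind U_env) => [|k u v IHu IHv|u v IHu IHv|Y].
- by rewrite t1 rmorph1.
- by rewrite linearP tsq_anti t_anti0 linearP IHu IHv.
- by rewrite rmorphM tsqM0 tM0 rmorphM IHu IHv.
by rewrite t_iota !Delta_prim (antilinearD c1 tsq_anti) !tsq_tens t1 !t_iota.
Qed.

Lemma twisted_coproduct_fps_map a :
  fps_map tsq (twisted_coproduct iota tens Delta a) =
  twisted_coproduct iota tens Delta (fps_map t a).
Proof.
have F_unit := twist_unit iota tens.
(* A right inverse of a unit is its inverse. *)
have tsqF : fps_map tsq (twist iota tens) = (twist iota tens)^-1.
  by apply: (mulrI F_unit); rewrite twist_fps_map mulrV.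
have tsqFV : fps_map tsq (twist iota tens)^-1 = twist iota tens.
  have FV_unit : (twist iota tens)^-1 \is a GRing.unit by rewrite unitrV.
  by apply: (mulIr FV_unit); rewrite -[X in _ * X = _]tsqF -tsqM !mulrV.
rewrite /twisted_coproduct tsqM tsqFV tsqM tsqF mulrA; congr (_ * _ * _).
by apply: fpsP => n /=; rewrite tsq_Delta.
Qed.

End TwistedCoproduct.

(** * Uniqueness of the extensions of theta, and the real form *)

Theorem mainTheorem7 (R : realType) (N : nat) (N_ge2 : (2 <= N)%N)
    (U : algType R[i]) (iota : {linear subvs_of (sl R[i] N) -> U})
    (U_env : is_enveloping_algebra (@sl_bracket R[i] N) iota)
    (T : algType R[i]) (tens : {bilinear U -> U -> T})
    (T_tens : is_tensor_algebra tens)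
    (Delta : {lrmorphism U -> T})
    (Delta_prim : forall Y,
       Delta (iota Y) = tens (iota Y) 1 + tens 1 (iota Y)) :
  [/\ {in sl R[i] N, forall A, theta A \in sl R[i] N},
      is_lie_antiautomorphism (@sl_bracket R[i] N) (@sl_theta R[i] N),
      exists! Theta : fps U -> fps U,
        is_antilinear_antihom Theta /\ extends_theta iota Theta &
      forall Theta : fps U -> fps U,
        is_antilinear_antihom Theta -> extends_theta iota Theta ->
        is_real_form tens (twisted_coproduct iota tens Delta) Theta].
Proof.
set C : numClosedFieldType := R[i].
have sl_theta_anti := @sl_theta_antiautomorphism C N.
have [th_anti _ th_br] := sl_theta_anti.
have [t t_antihom t_iota] := enveloping_antihom U_env th_anti th_br.
have [t_anti t1 tM] := t_antihom.
have c1 := rmorph1 (@Num.conj C); have fc1 := fps_conj1 C.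
(* Every extension is the coefficientwise one: by antilinearity it is determined on constant series,
   and there by its values on the generators [iota Y]. This yields uniqueness and reduces the last
   claim to [fps_map t]. *)
have Theta_eq (Theta : fps U -> fps U) :
    is_antilinear_antihom Theta -> extends_theta iota Theta ->
    Theta = fps_map t.
  move=> [Th_anti Th1 ThM] Th_iota; apply/funext.
  apply: antilinear_fps_ext => [||v]; [exact: Th_anti| |].
    exact: fps_map_antilinear.
  rewrite fps_map_const ?(antilinear0 c1 t_anti) //.
  move: v; apply: (enveloping_ind U_env) => [|k u v IHu IHv|u v IHu IHv|Y].
  - by rewrite t1 -fps_oneE Th1.
  - rewrite t_anti !fps_constD !fps_constZ Th_anti IHu IHv.
    by congr (_ *: _ + _); rewrite -(fps_map_const (f := Num.conj)) ?rmorph0.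
  - by rewrite tM !fps_constM ThM IHu IHv.
  by rewrite t_iota Th_iota.
split=> //; first exact: theta_sl.
  exists (fps_map t); split=> [|Theta [Th_antihom Th_iota]]; last first.
    by rewrite (Theta_eq Theta).
  split; first exact: fps_map_antihom.
  by move=> Y; rewrite fps_map_const ?(antilinear0 c1 t_anti) // t_iota.
move=> Theta Th_antihom Th_iota; rewrite (Theta_eq Theta) //.
have [tsq tsq_anti tsq_tens] := tensor_antilinear_map T_tens t_anti t_anti.
have tsq_antihom := tensor_antihom T_tens t_antihom t_antihom tsq_anti tsq_tens.
(* The same reduction for the tensor square, with pure tensors in place of the generators. *)
have TT_eq TT : is_tensor_square tens (fps_map t) TT -> TT = fps_map tsq.
  move=> [TT_anti TT_tens]; apply/funext.
  apply: antilinear_fps_ext => [||v]; [exact: TT_anti| |].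
    exact: fps_map_antilinear.
  rewrite fps_map_const ?(antilinear0 c1 tsq_anti) //.
  (* Fixing a coefficient leaves two maps from [T] to [T], antilinear over C, that can be compared
     on pure tensors. *)
  apply: fpsP => n; move: v.
  apply: (tensor_antilinear_ext T_tens) => [k u v|k u v|a b].
  - rewrite fps_constD fps_constZ TT_anti fps_coefD; congr (_ + _).
    have -> : fps_conj (fps_const k) = fps_const k^*.
      by rewrite /fps_conj fps_map_const ?rmorph0.
    rewrite fps_scaleE /= big_ord_recl /= subn0 big1 ?addr0 // => i _.
    by rewrite scale0r.
  - by case: n => [|n] /=; rewrite ?tsq_anti // scaler0 addr0.
  rewrite -fps_conv_const ?TT_tens => [|y|x]; rewrite ?linear0l ?linear0r //.
  rewrite tsq_tens !fps_map_const ?(antilinear0 c1 t_anti) //.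
  by rewrite fps_conv_const => [|y|x] //; rewrite ?linear0l ?linear0r.
have tsq_square : is_tensor_square tens (fps_map t) (fps_map tsq).
  by split; [exact: fps_map_antilinear | exact: fps_map_tens].
split; first exact: fps_map_antihom.
  by exists (fps_map tsq); split=> // TT /TT_eq.
move=> TT /TT_eq -> a.
exact: (twisted_coproduct_fps_map N_ge2 U_env).
Qed.
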